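(* Let $n\geq 1$ and let $u\in\mathbb{R}^n$ be a unit vector (that is, $\|u\|_2=1$) which is not orthogonal to any of the vertices of the cube $C_n=[-1,1]^n$. Let $\pi_u$ be the orthogonal projection of $\mathbb{R}^n$ onto $H_u$. Then there exists a vertex $\varepsilon$ of $C_n$ such that $\pi_u(\varepsilon)\in H_u\cap C_n$ if and only if $\|u\|_1\,\|u\|_\infty\leq 2$.
   Context: $\langle\cdot,\cdot\rangle$ is the standard inner product on $\mathbb{R}^n$. For $u=(u_1,\dots,u_n)\in\mathbb{R}^n$, $\|u\|_1=\sum_{k=1}^n|u_k|$, $\|u\|_2=\left(\sum_{k=1}^n u_k^2\right)^{1/2}$, $\|u\|_\infty=\max_{1\le k\le n}|u_k|$. The cube is $C_n=[-1,1]^n$; its vertices are the points of $\{-1,1\}^n$. For a unit vector $u\in\mathbb{R}^n$, $H_u=\{x\in\mathbb{R}^n:\langle x,u\rangle=0\}$ is the $(n-1)$-dimensional subspace orthogonal to $u$, and $\pi_u$ is the orthogonal projection onto $H_u$, i.e. $\pi_u(x)=x-\langle x,u\rangle u$ for all $x\in\mathbb{R}^n$. *)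

(* Defs.v *)
From HB Require Import structures.
From mathcomp Require Import all_boot all_order all_algebra.
From mathcomp Require Import boolp classical_sets reals.

Set Implicit Arguments.
Unset Strict Implicit.
Unset Printing Implicit Defensive.

Import Order.TTheory GRing.Theory Num.Theory.

Local Open Scope classical_set_scope.
Local Open Scope ring_scope.

Definition dotp (R : realType) (n : nat) (x y : 'rV[R]_n) : R :=
  \sum_(k < n) x 0 k * y 0 k.

Definition norm1 (R : realType) (n : nat) (u : 'rV[R]_n) : R :=
  \sum_(k < n) `|u 0 k|.

Definition norm2 (R : realType) (n : nat) (u : 'rV[R]_n) : R :=
  Num.sqrt (\sum_(k < n) u 0 k ^+ 2).

(* The default value 0 only matters for n = 0, as all entries are nonnegative. *)
Definition norminf (R : realType) (n : nat) (u : 'rV[R]_n) : R :=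
  \big[Num.max/0]_(k < n) `|u 0 k|.

Definition cube (R : realType) (n : nat) : set 'rV[R]_n :=
  [set x | forall k, -1 <= x 0 k <= 1].

Definition cube_vertices (R : realType) (n : nat) : set 'rV[R]_n :=
  [set x | forall k, x 0 k = -1 \/ x 0 k = 1].

Definition hyperplane (R : realType) (n : nat) (u : 'rV[R]_n) : set 'rV[R]_n :=
  [set x | dotp x u = 0].

(* This is the orthogonal projection onto hyperplane u when norm2 u = 1. *)
Definition proj (R : realType) (n : nat) (u x : 'rV[R]_n) : 'rV[R]_n :=
  x - dotp x u *: u.

Arguments cube R n : clear implicits.
Arguments cube_vertices R n : clear implicits.

(* Main.v *)
Require Import Defs.
From HB Require Import structures.
From mathcomp Require Import all_boot all_order all_algebra.
From mathcomp Require Import boolp classical_sets reals.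
From mathcomp Require Import lra.

(** Put t = <eps, u>. The k-th coordinate of pi_u(eps) is eps_k - t u_k, so for
    eps_k = +-1 it lies in [-1, 1] iff 0 <= eps_k t u_k <= 2. If this holds for
    all k, then t^2 = sum_k eps_k t u_k = sum_k |t u_k| = |t| ||u||_1; as t <> 0,
    |t| = ||u||_1, and the upper bounds say ||u||_1 |u_k| <= 2. Conversely, the
    sign vector of u has t = ||u||_1 and satisfies all these inequalities. *)

Import Order.TTheory GRing.Theory Num.Theory.

Local Open Scope classical_set_scope.
Local Open Scope ring_scope.

(** As [e] is a sign and [-1, 1] is symmetric, [e - s] may be replaced by
    [e * (e - s) = 1 - e * s]. *)
Lemma sign_sub_itv (R : realType) (e s : R) : e = -1 \/ e = 1 ->
  (-1 <= e - s <= 1) = (0 <= e * s <= 2).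
Proof.
by case=> ->; apply/idP/idP => /andP[h1 h2]; apply/andP; split; lra.
Qed.

Lemma hyperplane_proj (R : realType) (n : nat) (u x : 'rV[R]_n) :
  norm2 u = 1 -> hyperplane u (proj u x).
Proof.
move=> u_unit; rewrite /hyperplane /=.
have uu : dotp u u = 1.
  rewrite -[RHS](expr1n _ 2) -u_unit sqr_sqrtr; last by apply: sumr_ge0 => k _; exact: sqr_ge0.
  by apply: eq_bigr => k _; rewrite expr2.
have -> : dotp (proj u x) u = dotp x u - dotp x u * dotp u u.
  rewrite {1 2}/dotp [in RHS]/dotp mulr_sumr -sumrB; apply: eq_bigr => k _.
  by rewrite !mxE mulrBl mulrA.
by rewrite uu mulr1 subrr.
Qed.

Lemma proj_vertex_in_cube (R : realType) (n : nat) (u eps : 'rV[R]_n) :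
  cube_vertices R n eps ->
  cube R n (proj u eps) <->
  forall k, 0 <= eps 0 k * (dotp eps u * u 0 k) <= 2.
Proof.
move=> heps; split=> h k; have := h k; rewrite !mxE sign_sub_itv //; exact: heps.
Qed.

Lemma norm1_norminf_le (R : realType) (n : nat) (u : 'rV[R]_n) (c : R) :
  0 <= c ->
  norm1 u * norminf u <= c <-> forall k, norm1 u * `|u 0 k| <= c.
Proof.
move=> c_ge0.
have u1_ge0 : 0 <= norm1 u by apply: sumr_ge0.
split=> [h k | h].
  apply: le_trans h; apply: ler_wpM2l => //; exact: le_bigmax.
(* The default value 0 of the maximum is covered by [0 <= c]. *)
rewrite /norminf; elim/big_ind: _ => [|x y hx hy|k _]; first by rewrite mulr0.
  by rewrite maxEle; case: ifP.
exact: h.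
Qed.

Theorem theorem1 (R : realType) (n : nat) (n_ge1 : (1 <= n)%N) (u : 'rV[R]_n)
    (u_unit : norm2 u = 1)
    (u_vertices : forall v : 'rV[R]_n, cube_vertices R n v -> dotp v u <> 0) :
  (exists eps : 'rV[R]_n,
      cube_vertices R n eps /\ (hyperplane u `&` cube R n) (proj u eps))
  <-> norm1 u * norminf u <= 2.
Proof.
rewrite norm1_norminf_le //; split=> [[eps [heps [_ /proj_vertex_in_cube]]] | h].
  move=> /(_ heps) hcube.
  have t_neq0 := u_vertices _ heps; set t := dotp eps u in hcube t_neq0 *.
  have eps_norm k : `|eps 0 k| = 1 by case: (heps k) => ->; rewrite ?normrN normr1.
  (* By the lower bound, the right-hand side is its own absolute value. *)
  have abs_tu k : `|t| * `|u 0 k| = eps 0 k * (t * u 0 k).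
    by have /andP[ge0 _] := hcube k; rewrite -(ger0_norm ge0) !normrM eps_norm mul1r.
  have -> : norm1 u = `|t|.
    have nt_neq0 : `|t| != 0 by rewrite normr_eq0; apply/eqP.
    (* After multiplication by [|t|], only one factor of [t * t] is expanded, so that the sums match
       term by term via [abs_tu]. *)
    apply: (mulfI nt_neq0); rewrite -normrM -expr2 ger0_norm ?sqr_ge0 //.
    rewrite /norm1 mulr_sumr expr2 {2}/t /dotp mulr_sumr.
    by apply: eq_bigr => k _; rewrite abs_tu mulrCA.
  by move=> k; rewrite abs_tu; have /andP[] := hcube k.
(* Not Num.sg, which vanishes at 0 and would not give a vertex. *)
pose eps : 'rV[R]_n := \row_k (if 0 <= u 0 k then 1 else -1).
have heps : cube_vertices R n eps.
  by move=> k; rewrite mxE; case: ifP => _; [right | left].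
have eps_u k : eps 0 k * u 0 k = `|u 0 k|.
  rewrite mxE; case: ifPn => [/ger0_norm -> | ]; first by rewrite mul1r.
  by rewrite -ltNge => /ltr0_norm ->; rewrite mulN1r.
have dot_eps : dotp eps u = norm1 u by apply: eq_bigr => k _; exact: eps_u.
exists eps; split=> //; split; first exact: hyperplane_proj.
apply/proj_vertex_in_cube => // k.
(* The middle term becomes [norm1 u * |u 0 k|], which [h] bounds. *)
by rewrite dot_eps mulrCA eps_u h andbT mulr_ge0 // sumr_ge0.
Qed.
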